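(* $\mathrm{add}^*(\mathcal{NC})=\omega$ and $\mathrm{cof}^*(\mathcal{NC})=\mathfrak{c}$.
   Context: For $A\subseteq\omega\times\omega$ and $n<\omega$, $A(n)=\{m:(n,m)\in A\}$. $\mathcal{NC}=\{A\subseteq\omega\times\omega:\ \text{for every } X\in[\omega]^\omega,\ \{A(n):n\in X\}\text{ is not centered}\}$, where a family of subsets of $\omega$ is centered if all its finite nonempty subfamilies have infinite intersection. For an ideal $\mathcal{I}$ on a countable set $X$ (with $\subseteq^*$ meaning inclusion modulo finite): $\mathrm{add}^*(\mathcal{I})$ is the least size of $\mathcal{F}\subseteq\mathcal{I}$ such that there is no $I\in\mathcal{I}$ with $A\subseteq^* I$ for all $A\in\mathcal{F}$; $\mathrm{cof}^*(\mathcal{I})$ is the least size of $\mathcal{F}\subseteq\mathcal{I}$ such that every $A\in\mathcal{I}$ satisfies $A\subseteq^* B$ for some $B\in\mathcal{F}$. *)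

(* Defs.v *)
From mathcomp Require Import all_boot.
From mathcomp Require Import boolp classical_sets functions cardinality.
Set Implicit Arguments.
Unset Strict Implicit.
Unset Printing Implicit Defensive.
Local Open Scope classical_set_scope.
Local Open Scope card_scope.

Definition centered (F : set (set nat)) : Prop :=
  forall G : set (set nat), G `<=` F -> finite_set G -> G !=set0 ->
    infinite_set (\bigcap_(B in G) B).

(* [xsection A n] is the vertical section A(n) = {m : (n, m) in A}. *)
Definition NC : set (set (nat * nat)) :=
  [set A | forall X : set nat, infinite_set X -> ~ centered (xsection A @` X)].

Definition almost_subset (T : Type) (A B : set T) : Prop := finite_set (A `\` B).

(* Cardinal numbers are represented by sets having that cardinality: the least
   size of a family satisfying P is the cardinal of K. *)
Definition is_least_size (T U : Type) (P : set (set T)) (K : set U) : Prop :=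
  (exists2 F, P F & F #= K) /\ (forall F, P F -> K #<= F).

Definition is_add_star (T U : Type) (I : set (set T)) (K : set U) : Prop :=
  is_least_size
    [set F : set (set T) | F `<=` I /\
       ~ exists2 J, I J & forall A, F A -> almost_subset A J] K.

Definition is_cof_star (T U : Type) (I : set (set T)) (K : set U) : Prop :=
  is_least_size
    [set F : set (set T) | F `<=` I /\
       forall A, I A -> exists2 B, F B & almost_subset A B] K.

Definition omega : set nat := [set: nat].

(* The continuum is 2^omega, the cardinality of the power set of omega. *)
Definition continuum : set (set nat) := [set: set nat].

(* Main.v *)
Require Import Defs.
From mathcomp Require Import all_boot.
From mathcomp Require Import boolp classical_sets functions cardinality.
From mathcomp Require Import filter.

(** A set A belongs to NC iff no nonprincipal ultrafilter contains infinitely many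
    sections of A; hence NC is closed under finite unions, while the countably
    many columns {n} x omega have no upper bound in NC, which settles add*.

    For cof*, identify omega with the nodes of the binary tree, and attach to
    each branch x the set in NC whose n-th section consists of the nodes leaving
    x at level n. A member J of NC can almost contain these sets only for a set
    of branches without accumulation point in itself, which is therefore
    countable. A cofinal family F thus induces a countable-to-one map from
    2^omega to F, and König's diagonal argument gives c <= |F|. *)

Set Implicit Arguments.
Unset Strict Implicit.
Unset Printing Implicit Defensive.
Local Open Scope classical_set_scope.
Local Open Scope card_scope.

Lemma centered_subset_filter (U : set (set nat)) (F : set (set nat)) :
  Filter U -> (forall V, U V -> infinite_set V) -> F `<=` U -> centered F.
Proof.
move=> UF Uinf FU G GF /finite_fsetP[X GX] _; apply: Uinf; rewrite GX.
by apply: filter_bigI => V VX; apply/FU/GF; rewrite GX.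
Qed.

(** Finite intersections from [F] with finite sets removed form a base of a proper filter; an
    ultrafilter extending it contains all cofinite sets. *)
Lemma centered_ultrafilter (F : set (set nat)) : centered F ->
  exists U : set (set nat),
    [/\ UltraFilter U, F `<=` U & forall V, U V -> infinite_set V].
Proof.
move=> cF.
pose D := [set p : set (set nat) * set nat |
  [/\ p.1 `<=` F, finite_set p.1 & finite_set p.2]].
pose B (p : set (set nat) * set nat) := (\bigcap_(C in p.1) C) `\` p.2.
have FB : Filter (filter_from D B).
  apply: filter_from_filter; first by exists (set0, set0); split=> //=; exact: sub0set.
  move=> [G1 E1] [G2 E2] [/= G1F fG1 fE1] [/= G2F fG2 fE2].
  exists (G1 `|` G2, E1 `|` E2).
    by split; rewrite ?finite_setU//= => C [/G1F|/G2F].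
  move=> m [/= mG mE]; split; (split=> [C GC|Em]; last by apply: mE; tauto).
    by apply: mG; left.
  by apply: mG; right.
have /ultraFilterLemma[U [UU BU]] : ProperFilter (filter_from D B).
  apply: filter_from_proper => -[G E] [/= GF fG fE].
  apply: infinite_setN0; apply: infinite_setD => //=.
  (* Centeredness says nothing about the empty subfamily, whose intersection is all of [nat]. *)
  have [->|/set0P G0] := eqVneq G set0; last exact: cF.
  by rewrite bigcap_set0; exact: infinite_nat.
exists U; split=> // [C FC|V UV fV].
  apply: BU; exists ([set C], set0); last by move=> m [+ _]; apply.
  by split=> //= _ ->.
have UnV : U (~` V).
  by apply: BU; exists (set0, V); [split=> //=; exact: sub0set|move=> m []].
by apply: (filter_not_empty U); rewrite -(setICr V); exact: filterI.
Qed.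

Lemma NC_setU A B : NC A -> NC B -> NC (A `|` B).
Proof.
move=> NA NB X Xinf /centered_ultrafilter[U [UU XU Uinf]].
have ABU n : X n -> U (xsection A n) \/ U (xsection B n).
  move=> Xn; have [|UnA] := in_ultra_setVsetC (xsection A n) UU; first by left.
  right; have : U (xsection (A `|` B) n) by apply: XU; exists n.
  move=> /(filterI UnA); apply: filterS => m [nA].
  by rewrite !xsectionE in nA * => -[].
have NCfin C : NC C -> finite_set [set n | X n /\ U (xsection C n)].
  move=> NCC; apply: contrapT => /NCC; apply.
  by apply: centered_subset_filter Uinf _ => _ [n [_ Un] <-].
apply: Xinf; apply: sub_finite_set (_ : finite_set
  ([set n | X n /\ U (xsection A n)] `|` [set n | X n /\ U (xsection B n)])).
  by move=> n Xn; have [|] := ABU n Xn; [left|right].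
by rewrite finite_setU; split; apply: NCfin.
Qed.

Lemma infinite_set_two_points T (X : set T) :
  infinite_set X -> exists x y, [/\ X x, X y & x <> y].
Proof.
move=> /[dup] /infinite_setN0[x Xx] /infinite_setD/(_ (finite_set1 x)).
by move=> /infinite_setN0[y [Xy /= yx]]; exists x, y; split=> // /esym.
Qed.

Lemma NC_disjoint_sections A :
  (forall n n' m, A (n, m) -> A (n', m) -> n = n') -> NC A.
Proof.
move=> Adisj X /infinite_set_two_points[n [n' [Xn Xn' nn']]].
move=> /(_ [set xsection A n; xsection A n']); apply.
- by move=> _ [->|->]; [exists n|exists n'].
- exact: finite_set2.
- by exists (xsection A n); left.
apply: sub_finite_set (finite_set0 nat) => m mA.
apply/nn'/(Adisj _ _ m); apply/xsectionP; apply: mA; [by left|by right].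
Qed.

(** Otherwise every finite intersection of these sections contains [S] up to a finite set, so the
    sections over [X] are centered. *)
Lemma NC_not_pseudointersection J (X S : set nat) : NC J ->
  infinite_set X -> infinite_set S ->
  ~ forall n, X n -> almost_subset S (xsection J n).
Proof.
move=> NJ Xinf Sinf SJ; apply: (NJ _ Xinf) => G GX fG _.
apply: (@sub_infinite_set _ (S `\` \bigcup_(B in G) (S `\` B))).
  move=> m [Sm nm] B GB; apply: contrapT => nBm.
  by apply: nm; exists B.
apply: infinite_setD => //; apply: bigcup_finite => // _ /GX[n Xn <-].
exact: SJ.
Qed.

Lemma NC_finite_bounded (F : set (set (nat * nat))) : F `<=` NC ->
  finite_set F -> exists2 J, NC J & forall A, F A -> almost_subset A J.
Proof.
move=> FNC /finite_seqP[s Fs]; exists (\bigcup_(A in F) A); last first.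
  move=> A FA; rewrite /almost_subset.
  apply: sub_finite_set (@finite_set0 (nat * nat)) => p [Ap np].
  by apply: np; exists A.
rewrite Fs in FNC *; rewrite bigcup_seq big_seq.
elim/big_ind : _ => [| |A As]; last exact: FNC.
- exact: NC_disjoint_sections.
- exact: NC_setU.
Qed.

Lemma almost_subset_xsection (T1 T2 : Type) (A B : set (T1 * T2)) n :
  almost_subset A B -> almost_subset (xsection A n) (xsection B n).
Proof.
move=> AB; apply: sub_finite_set (finite_image snd AB) => m [Am Bm].
exists (n, m) => //; split; first exact/xsectionP.
by move=> /xsectionP.
Qed.

Lemma add_star_NC : is_add_star NC omega.
Proof.
pose column (n : nat) : set (nat * nat) := [set n] `*` setT.
have xcolumn n : xsection (column n) n = setT.
  by rewrite in_xsectionX//; exact: mem_set.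
split; last first.
  move=> F [FNC Funb]; apply/infiniteP => fF.
  exact/Funb/NC_finite_bounded.
exists (range column); last first.
  apply: inj_card_eq => n n' _ _ nn'.
  have : column n (n, 0) by [].
  by rewrite nn' => -[].
split.
  by move=> _ [k _ <-]; apply: NC_disjoint_sections => n n' m [/= -> _] [/= -> _].
move=> [J NJ colJ].
(* A bound of all columns would have only cofinite sections. *)
apply: (NC_not_pseudointersection NJ infinite_nat infinite_nat) => n _.
rewrite -(xcolumn n); apply: almost_subset_xsection; apply: colJ.
by exists n.
Qed.

Definition prefix_code (x : nat -> bool) (l : nat) : nat := pickle (mkseq x l).

Lemma prefix_codeP x l y l' :
  prefix_code x l = prefix_code y l' <->
  l = l' /\ forall i, i < l -> x i = y i.
Proof.
split=> [/(pcan_inj pickleK) exy|[<- exy]]; last first.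
  congr pickle; apply: (@eq_from_nth _ false); rewrite !size_mkseq// => i il.
  by rewrite !nth_mkseq// exy.
have ll' : l = l' by rewrite -(size_mkseq x l) exy size_mkseq.
split=> // i il; have := congr1 (nth false ^~ i) exy.
by rewrite !nth_mkseq// -ll'.
Qed.

(* With natural numbers read as codes of nodes of the binary tree, the n-th
   section consists of the nodes that leave the branch x exactly at level n. *)
Definition branching (x : nat -> bool) : set (nat * nat) :=
  [set p | exists y l, [/\ p.2 = prefix_code y l, p.1 < l,
     forall i, i < p.1 -> y i = x i & y p.1 <> x p.1]].

Lemma NC_branching x : NC (branching x).
Proof.
suff dis n n' m : branching x (n, m) -> branching x (n', m) -> n <= n'.
  by apply: NC_disjoint_sections => n n' m mn mn'; apply/eqP;
     rewrite eqn_leq (dis n n' m)// (dis n' n m).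
move=> [y [l [/= -> nl yx yxn]]] [z [l' [/= /prefix_codeP[_ yz] nl' zx zxn]]].
(* If [n' < n], the common node still follows [x] at level [n']. *)
rewrite leqNgt; apply/negP => n'n; apply: zxn.
by rewrite -yz ?yx// (ltn_trans n'n).
Qed.

(* If x were a limit of other such branches x', then above each level where some
   x' splits from x, almost all nodes of x would belong to that section of J. *)
Lemma NC_branching_isolated J x : NC J ->
  exists n, forall x', almost_subset (branching x') J ->
    (forall i, i < n -> x' i = x i) -> x' = x.
Proof.
move=> NJ; apply: contrapT => /forallNP Hn.
pose X := [set n | exists x', [/\ almost_subset (branching x') J,
   forall i, i < n -> x' i = x i & x' n <> x n]].
have Xinf : infinite_set X.
  (* A branch agreeing with [x] up to the maximum of [X] would first leave [x] at a larger level,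
     again in [X]. *)
  move=> /finite_seqP[Y XY]; have := Hn (\max_(n <- Y) n).+1.
  apply=> x' x'J x'x; apply: contrapT => x'Nx.
  have ex : exists n, x' n != x n.
    apply: contra_notP x'Nx => /forallNP x'Ex; apply: funext => i.
    by have /negP/negPn/eqP := x'Ex i.
  have [n /eqP x'n minn] := ex_minnP ex.
  have : X n.
    exists x'; split=> // i; rewrite ltnNge => ni; apply/eqP; apply: contraNT ni.
    exact: minn.
  rewrite XY /= => nY; apply: x'n; apply: x'x; rewrite ltnS.
  exact: (@leq_bigmax_seq _ Y xpredT id).
have inj : injective (prefix_code x) by move=> l l' /prefix_codeP[].
apply: (@NC_not_pseudointersection J X (range (prefix_code x)) NJ Xinf).
  by move=> /(finite_preimage (in2W inj)); rewrite preimage_range; exact: infinite_nat.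
move=> n [x' [x'J x'x x'n]].
(* Nodes of [x] of length at most [n] are too short to show the split from [x'] at level [n]. *)
apply: (@sub_finite_set _ _ ((prefix_code x @` `I_n.+1) `|`
   (xsection (branching x') n `\` xsection J n))); last first.
  rewrite finite_setU; split; first exact/finite_image/finite_II.
  exact: almost_subset_xsection.
move=> _ [[l _ <-] nJ]; have [ln|nl] := leqP l n; first by left; exists l.
right; split=> //; apply/xsectionP; exists x, l; split=> //= [i /x'x|/esym]//.
Qed.

(* A diagonal argument in the style of König: were no fibre of r mapped onto
   nat -> bool by its own coordinate, the missed values would form a sequence
   lying in no fibre. *)
Lemma countable_to_one_card_le T (F : set T) (f : (nat -> bool) -> T)
    (r : (nat -> bool) -> nat) :
  (forall x, F (f x)) -> (forall x y, f x = f y -> r x = r y -> x = y) ->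
  [set: set nat] #<= F.
Proof.
move=> Ff inj_fr.
pose row (x : nat -> bool) (k j : nat) := x (pickle (k, j)).
have [k kP] : exists k, forall d, exists x, r x = k /\ row x k = d.
  apply: contrapT => /forallNP H.
  have /choice[d dP] k : exists d, forall x, r x = k -> row x k <> d.
    have /existsNP[d /forallNP dk] := H k.
    by exists d => x rx xd; apply: (dk x).
  (* Row [k] of this [x] is [d k] for all [k], in particular for [k = r x]. *)
  pose x m := if unpickle m is Some (k, j) then d k j else false.
  by apply: (dP (r x) x) => //; apply: funext => j; rewrite /row /x pickleK.
have /choice[g gP] := kP.
(* All values of [g] lie in the single fibre of [r] over [k], where [f] is injective. *)
pose h (S : set nat) := f (g (fun j => `[< S j >])).
apply: card_le_trans (subset_card_le (_ : range h `<=` F)); last first.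
  by move=> _ [S _ <-]; exact: Ff.
rewrite -(card_le_eql (_ : range h #= setT)) ?card_lexx//; apply: inj_card_eq.
move=> S S' _ _ /inj_fr.
have [rS wS] := gP (fun j => `[< S j >]).
have [rS' wS'] := gP (fun j => `[< S' j >]).
rewrite rS rS' => /(_ erefl) SS'; rewrite {}SS' wS' in wS.
apply: funext => j; apply: propext; apply: asbool_eq_equiv.
exact: (congr1 (@^~ j) (esym wS)).
Qed.

Lemma cof_star_NC_ge (F : set (set (nat * nat))) : F `<=` NC ->
  (forall A, NC A -> exists2 B, F B & almost_subset A B) -> continuum #<= F.
Proof.
move=> FNC Fcof.
have /choice[f fP] x : exists B, F B /\ almost_subset (branching x) B.
  by have [B FB xB] := Fcof _ (@NC_branching x); exists B.
have /choice[n nP] x := NC_branching_isolated x (FNC _ (fP x).1).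
(* Equal codes put [y] in the neighbourhood of [x] that isolates it among branches bounded by
   [f x]. *)
apply: (@countable_to_one_card_le _ F f (fun x => prefix_code x (n x))).
  by move=> x; exact: (fP x).1.
move=> x y fxy /prefix_codeP[_ xy]; apply/esym/nP.
  by rewrite fxy; exact: (fP y).2.
by move=> i /xy.
Qed.

Lemma cof_star_NC : is_cof_star NC continuum.
Proof.
split=> [|F [FNC Fcof]]; last exact: cof_star_NC_ge.
have NCcof A : NC A -> exists2 B, NC B & almost_subset A B.
  by exists A => //; rewrite /almost_subset setDv.
(* [NC] is cofinal in itself and has at most continuum many members. *)
exists NC; first by split.
apply/card_eqPle; split; last exact: cof_star_NC_ge.
apply: card_le_trans (subset_card_le (@subsetT _ NC)) _.
apply/pcard_injP; exists (fun A => pickle @` A) => A B _ _.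
have inj : injective (pickle : nat * nat -> nat) := pcan_inj pickleK.
by move=> AB; apply: funext => p; rewrite -(image_inj inj) AB image_inj.
Qed.

Theorem theorem4p4 : is_add_star NC omega /\ is_cof_star NC continuum.
Proof. by split; [exact: add_star_NC|exact: cof_star_NC]. Qed.
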